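(* Let $a,b\in\mathbb{R}\setminus\{0\}$, let $$W(x)=e^{-x^{2}}\begin{pmatrix} e^{2bx}+a^{2}x^{2} & ax\\ ax & 1\end{pmatrix},\quad x\in\mathbb{R},$$ and let $$D=\partial^{2}I+\partial\begin{pmatrix}-2x+2b & -2abx+2a\\ 0 & -2x\end{pmatrix}+\begin{pmatrix}-2&0\\0&0\end{pmatrix}\in\mathcal D(W).$$ If $\mathfrak D\in\mathcal D(W)$ is a differential operator commuting with $D$, then $\mathfrak D$ is a polynomial in $D$ (with complex coefficients).
   Context: Differential operators $\mathfrak D=\sum_{j=0}^s\partial^jF_j(x)$, $\partial=\frac{d}{dx}$, with $F_j\in\operatorname{Mat}_2(\mathbb{C}[x])$, act on the right on $2\times2$ matrix-valued functions by $P\mathfrak D=\sum_jP^{(j)}(x)F_j(x)$; $\operatorname{Mat}_2(\Omega[x])$ denotes the algebra of these, with product given by $P(\mathfrak D_1\mathfrak D_2)=(P\mathfrak D_1)\mathfrak D_2$. Let $\{P_n\}_{n\ge0}$ be the sequence of monic orthogonal polynomials in $\operatorname{Mat}_2(\mathbb{C}[x])$ for $\langle P,Q\rangle=\int_{\mathbb{R}}P(x)W(x)Q(x)^*dx$ ($P_n$ of degree $n$ with leading coefficient $I$, $\langle P_n,P_m\rangle=0$ for $n\ne m$). Then $$\mathcal D(W)=\{\mathfrak D\in\operatorname{Mat}_2(\Omega[x]): P_n\mathfrak D=\Lambda_n(\mathfrak D)P_n\text{ with }\Lambda_n(\mathfrak D)\in\operatorname{Mat}_2(\mathbb{C}),\text{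 for all }n\in\mathbb{N}_0\}.$$ *)

(* Defs.v *)
From HB Require Import structures.
From mathcomp Require Import all_boot all_order all_algebra.
From mathcomp Require Import all_classical all_reals all_analysis.
From mathcomp Require Import complex.

Set Implicit Arguments.
Unset Strict Implicit.
Unset Printing Implicit Defensive.

Import Order.TTheory GRing.Theory Num.Theory.

Local Open Scope ring_scope.
Local Open Scope complex_scope.

Definition mx2 (T : Type) (a b c d : T) : 'M[T]_2 :=
  \matrix_(i < 2, j < 2)
    if i == 0 then (if j == 0 then a else b) else (if j == 0 then c else d).

Section DifferentialOperators.
Variable K : comNzRingType.

Notation pmx := 'M[{poly K}]_2.

(* The operator sum_j \partial^j F_j(x) is encoded by its coefficients: it is
   the polynomial in \partial over Mat_2(K[x]) whose j-th coefficient is F_j.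
   Only the additive structure of {poly 'M_2} is that of the operators: in its
   native product \partial would be central, so the composition product is
   [opmul] below, never *%R. *)
Definition diffop : Type := {poly pmx}.

Definition deriv_mx (P : pmx) : pmx := map_mx (@deriv K) P.

Definition act (P : pmx) (D : diffop) : pmx :=
  \sum_(j < size D) iter j deriv_mx P *m D`_j.

(* The product D \partial, by F \partial = \partial F + F'; here P \partial
   is P', so P (F \partial) = (P F)' = P' F + P F'. *)
Definition mul_partial (D : diffop) : diffop :=
  D * 'X + map_poly deriv_mx D.

Definition opmul (D1 D2 : diffop) : diffop :=
  \sum_(j < size D2) iter j mul_partial D1 * (D2`_j)%:P.

Definition opexp (D : diffop) (n : nat) : diffop := iter n (opmul D) 1.

Definition opscale (c : K) (D : diffop) : diffop := (c%:P)%:M *: D.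

(* The value p(D) of a polynomial p with scalar coefficients at D. *)
Definition op_horner (p : {poly K}) (D : diffop) : diffop :=
  \sum_(k < size p) opscale p`_k (opexp D k).

Fact deriv_mx_is_zmod_morphism : zmod_morphism deriv_mx.
Proof. by move=> P Q; apply/matrixP=> i j; rewrite !mxE derivB. Qed.

HB.instance Definition _ :=
  GRing.isZmodMorphism.Build pmx pmx deriv_mx deriv_mx_is_zmod_morphism.

Lemma deriv_mxM (P Q : pmx) :
  deriv_mx (P *m Q) = deriv_mx P *m Q + P *m deriv_mx Q.
Proof.
apply/matrixP=> i j; rewrite !mxE raddf_sum -big_split /=.
by apply: eq_bigr => k _; rewrite derivM !mxE.
Qed.

Lemma act_widen (P : pmx) (D : diffop) (n : nat) : (size D <= n)%N ->
  act P D = \sum_(j < n) iter j deriv_mx P *m D`_j.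
Proof.
move=> le_n; rewrite /act (big_ord_widen n (fun j => iter j deriv_mx P *m D`_j) le_n).
rewrite big_mkcond; apply: eq_bigr => j _; case: ltnP => // le_j.
by rewrite nth_default ?mulmx0.
Qed.

Lemma act0 (P : pmx) : act P 0 = 0.
Proof. by rewrite /act size_poly0 big_ord0. Qed.

Lemma actD (P : pmx) (D E : diffop) : act P (D + E) = act P D + act P E.
Proof.
set n := maxn (size D) (size E).
rewrite (@act_widen P (D + E) n) ?size_polyD //.
rewrite (@act_widen P D n) ?leq_maxl // (@act_widen P E n) ?leq_maxr //.
by rewrite -big_split; apply: eq_bigr => j _; rewrite coefD mulmxDr.
Qed.

Lemma actMC (P : pmx) (D : diffop) (F : pmx) : act P (D * F%:P) = act P D *m F.
Proof.
rewrite (@act_widen P _ (size D)).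
  rewrite /act mulmx_suml; apply: eq_bigr => j _.
  by rewrite coefMC mulmxA.
by apply/leq_sizeP => j le_j; rewrite coefMC nth_default ?mul0r.
Qed.

Lemma act_mul_partial (P : pmx) (D : diffop) :
  act P (mul_partial D) = deriv_mx (act P D).
Proof.
rewrite /mul_partial actD.
rewrite (@act_widen P (D * 'X) (size D).+1); last first.
  by apply/leq_sizeP => j le_j; rewrite coefMX; case: j le_j => // j le_j;
     rewrite nth_default.
rewrite (@act_widen P (map_poly _ D) (size D)) ?size_poly //.
rewrite big_ord_recl coefMX mulmx0 add0r raddf_sum -big_split /=.
by apply: eq_bigr => j _; rewrite coefMX /= coef_map deriv_mxM.
Qed.

Theorem act_opmul (P : pmx) (D1 D2 : diffop) :
  act P (opmul D1 D2) = act (act P D1) D2.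
Proof.
rewrite /opmul.
rewrite (big_morph (act P) (@actD P) (@act0 P)); apply: eq_bigr => j _.
rewrite actMC; congr (_ *m _).
by elim: (j : nat) => //= k <-; rewrite act_mul_partial.
Qed.

End DifferentialOperators.

(* Over a field of characteristic 0 an operator is determined by its action on
   polynomial matrices, so equality of coefficients is equality of operators. *)
Theorem act_inj (K : numDomainType) (D1 D2 : diffop K) :
  (forall P, act P D1 = act P D2) -> D1 = D2.
Proof.
move=> eqD; apply/eqP; rewrite -subr_eq0; apply/eqP/polyP => n; rewrite coef0.
have actE P : act P (D1 - D2) = 0.
  by apply: (addIr (act P D2)); rewrite -actD add0r subrK eqD.
elim/ltn_ind: n => n IHn; pose E := D1 - D2.
have iterE k j : iter j (@deriv_mx K) ('X^k)%:M = ('X^(k - j) *+ k ^_ j)%:M.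
  elim: j => [|j IHj] /=; first by rewrite subn0 ffactn0.
  rewrite IHj; apply/matrixP=> i l; rewrite !mxE raddfMn /= derivMn derivXn.
  by rewrite subnS ffactnSr mulnC mulrnA.
have := actE ('X^n)%:M; rewrite (@act_widen _ _ _ (maxn n.+1 (size E))) ?leq_maxr //.
have lt_n : (n < maxn n.+1 (size E))%N by rewrite leq_max ltnSn.
rewrite (bigD1 (Ordinal lt_n)) //= big1 ?addr0 => [|j /eqP ne_j].
  rewrite iterE subnn expr0 mul_scalar_mx => En0.
  apply/matrixP=> i l; move/matrixP/(_ i l)/eqP: En0.
  rewrite !mxE mulrnAl mul1r -mulr_natr mulf_eq0 -polyC_natr polyC_eq0.
  by rewrite pnatr_eq0 ffactnn eqn0Ngt fact_gt0 orbF => /eqP.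
have [lt_jn|lt_nj|eq_jn] := ltngtP (j : nat) n.
- by rewrite IHn ?mulmx0.
- by rewrite iterE ffact_small // mulr0n raddf0 mul0mx.
- by case: ne_j; apply: val_inj.
Qed.

Section OrthogonalPolynomials.
Variable R : realType.

Notation C := R[i].

Definition integralC (f : R -> C) : C :=
  (\int[@lebesgue_measure R]_(x in setT) complex.Re (f x))
  +i* (\int[@lebesgue_measure R]_(x in setT) complex.Im (f x)).

Definition eval_mx (P : 'M[{poly C}]_2) (x : R) : 'M[C]_2 :=
  map_mx (fun p : {poly C} => p.[x%:C]) P.

Definition adjoint_mx (A : 'M[C]_2) : 'M[C]_2 := (map_mx (@conjc R) A)^T.

Definition mxip (W : R -> 'M[C]_2) (P Q : 'M[{poly C}]_2) : 'M[C]_2 :=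
  \matrix_(i < 2, j < 2)
    integralC (fun x => (eval_mx P x *m W x *m adjoint_mx (eval_mx Q x)) i j).

Definition monic_mxpoly (n : nat) (P : 'M[{poly C}]_2) : Prop :=
  (forall i j, (size (P i j) <= n.+1)%N) /\ map_mx (fun p : {poly C} => p`_n) P = 1%:M.

Definition monic_orthogonal (W : R -> 'M[C]_2) (P : nat -> 'M[{poly C}]_2) : Prop :=
  (forall n, monic_mxpoly n (P n)) /\
  (forall n m, n <> m -> mxip W (P n) (P m) = 0).

(* Membership in D(W), where P is the sequence of monic orthogonal polynomials
   for W. *)
Definition in_DW (P : nat -> 'M[{poly C}]_2) (D : diffop C) : Prop :=
  forall n, exists L : 'M[C]_2, act (P n) D = map_mx polyC L *m P n.

Definition weight (a b : R) (x : R) : 'M[C]_2 :=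
  (expR (- x ^+ 2))%:C *:
    mx2 (expR (2 * b * x) + a ^+ 2 * x ^+ 2)%:C (a * x)%:C
        (a * x)%:C                              1.

Definition opD (a b : R) : diffop C :=
  Poly [:: mx2 (- 2)%:P 0
               0        0;
           mx2 (- 2 *: 'X + (2 * b)%:C%:P) (- (2 * a * b)%:C *: 'X + (2 * a)%:C%:P)
               0                           (- 2 *: 'X);
           1%:M].

End OrthogonalPolynomials.

(* Main.v *)
Require Import Defs.
From mathcomp Require Import all_boot all_order all_algebra.
From mathcomp Require Import all_classical all_reals all_analysis.
From mathcomp Require Import complex polyrcf measurable_realfun ring lra.

Set Implicit Arguments.
Unset Strict Implicit.
Unset Printing Implicit Defensive.

Import Order.TTheory GRing.Theory Num.Theory.

Local Open Scope ring_scope.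
Local Open Scope complex_scope.

(* Put T = [[1, a x], [0, 1]]. Then W = T diag(e^(-x^2 + 2bx), e^(-x^2)) T^*,
   and T^-1 D T is the diagonal operator with entries
   d^2 + d (2b - 2x) - 2 and d^2 - 2 d x, each symmetric for its own weight.
   Hence D is symmetric for W and does not raise degrees, so D is in D(W), with
   eigenvalues Lambda_n = [[-2(n+1), -2abn], [0, -2n]].

   If E commutes with D, then E' = T^-1 E T commutes with T^-1 D T. The
   coefficients e_k of an off-diagonal entry of E' vanish, since a top one would
   satisfy e' = b e or e' = - b e. If E is moreover in D(W) with eigenvalues L_n,
   then L_n commutes with Lambda_n, so L_n is determined by its diagonal
   (s_n, t_n); since E' is diagonal while E does not raise the degree of the
   row (x^n, 0), which T maps to (x^n, a x^(n+1)), also s_n = t_(n+1). As t_n is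
   polynomial in n, t_n = p(-2n) for some p, and then L_n = p(Lambda_n). *)

(** * Polynomial matrices and the action of operators *)

Lemma ord2_eq (k : 'I_2) : k = 0 \/ k = 1.
Proof. by case: k => [[|[|//]] ?]; [left|right]; apply/val_inj. Qed.

Section Mx2.
Variable T : Type.

Lemma mx2E (a b c d : T) : ((mx2 a b c d 0 0 = a) * (mx2 a b c d 0 1 = b) *
  (mx2 a b c d 1 0 = c) * (mx2 a b c d 1 1 = d))%type.
Proof. by rewrite /mx2 !mxE. Qed.

Lemma eq_mx2 (A B : 'M[T]_2) : A 0 0 = B 0 0 -> A 0 1 = B 0 1 ->
  A 1 0 = B 1 0 -> A 1 1 = B 1 1 -> A = B.
Proof.
move=> h00 h01 h10 h11; apply/matrixP => i j.
by case: (ord2_eq i) => ->; case: (ord2_eq j) => ->.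
Qed.

End Mx2.

Lemma mulmx2E (K : comPzRingType) (A B : 'M[K]_2) i j :
  (A *m B) i j = A i 0 * B 0 j + A i 1 * B 1 j.
Proof.
by rewrite mxE !big_ord_recl big_ord0 addr0; congr (_ * _ + A i _ * B _ j);
  apply/val_inj.
Qed.

Lemma sum_ord2 (V : nmodType) (F : 'I_2 -> V) : \sum_(i < 2) F i = F 0 + F 1.
Proof. by rewrite !big_ord_recl big_ord0 addr0; congr (_ + F _); apply/val_inj. Qed.

Section MatrixPolynomials.
Variable K : comNzRingType.
Implicit Types (P Q : 'M[{poly K}]_2) (A : 'M[K]_2).

(** As with [size], the bound [n] means that all entries have degree below n. *)
Definition mxsize_le n P := forall i j, (size (P i j) <= n)%N.

Definition mxcoef n P : 'M[K]_2 := map_mx (fun p : {poly K} => p`_n) P.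

Lemma mxcoefE n P i j : mxcoef n P i j = (P i j)`_n. Proof. exact: mxE. Qed.

Lemma mxsize_leP n P :
  mxsize_le n P <-> (forall m, (n <= m)%N -> mxcoef m P = 0).
Proof.
split=> [szP m le_nm|coP i j].
  by apply/matrixP => i j; rewrite mxcoefE mxE nth_default// (leq_trans (szP i j)).
by apply/leq_sizeP => m /coP/matrixP/(_ i j); rewrite mxcoefE mxE.
Qed.

Lemma mxcoefD n P Q : mxcoef n (P + Q) = mxcoef n P + mxcoef n Q.
Proof. by apply/matrixP => i j; rewrite !mxE coefD. Qed.

Lemma mxcoefN n P : mxcoef n (- P) = - mxcoef n P.
Proof. by apply/matrixP => i j; rewrite !mxE coefN. Qed.

Lemma mxcoefB n P Q : mxcoef n (P - Q) = mxcoef n P - mxcoef n Q.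
Proof. by rewrite mxcoefD mxcoefN. Qed.

Lemma mxcoef_mul n A P : mxcoef n (map_mx polyC A *m P) = A *m mxcoef n P.
Proof.
apply/matrixP => i j; rewrite mxcoefE !mulmx2E !mxE coefD !coefCM //.
Qed.

Lemma mxcoef_deriv n P : mxcoef n (deriv_mx P) = mxcoef n.+1 P *+ n.+1.
Proof. by apply/matrixP => i j; rewrite mulmxnE !mxE coef_deriv. Qed.

Lemma deriv_mxC A : deriv_mx (map_mx polyC A) = 0.
Proof. by apply/matrixP => i j; rewrite !mxE derivC. Qed.

Lemma iter_deriv_mx0 k : iter k (@deriv_mx K) 0 = 0.
Proof. by elim: k => //= k ->; rewrite raddf0. Qed.

Lemma iter_deriv_mxD k P Q :
  iter k (@deriv_mx K) (P + Q) = iter k (@deriv_mx K) P + iter k (@deriv_mx K) Q.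
Proof. by elim: k => //= k ->; rewrite raddfD. Qed.

Lemma iter_deriv_mxM k A P : iter k (@deriv_mx K) (map_mx polyC A *m P) =
  map_mx polyC A *m iter k (@deriv_mx K) P.
Proof.
by elim: k => //= k ->; rewrite deriv_mxM deriv_mxC mul0mx add0r.
Qed.

Lemma actDl P Q (E : diffop K) : act (P + Q) E = act P E + act Q E.
Proof.
rewrite /act -big_split; apply: eq_bigr => j _.
by rewrite iter_deriv_mxD mulmxDl.
Qed.

Lemma act0l (E : diffop K) : act 0 E = 0.
Proof. by rewrite /act big1// => j _; rewrite iter_deriv_mx0 mul0mx. Qed.

Lemma actMl A P (E : diffop K) :
  act (map_mx polyC A *m P) E = map_mx polyC A *m act P E.
Proof.
by rewrite /act mulmx_sumr; apply: eq_bigr => j _; rewrite iter_deriv_mxM mulmxA.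
Qed.

Lemma act_polyC P (F : 'M[{poly K}]_2) : act P F%:P = P *m F.
Proof.
by rewrite (@act_widen _ _ _ 1) ?size_polyC_leq1// big_ord1 coefC.
Qed.

(** * Coefficients of products with a second-order operator *)

Section CoefficientOfCommutator.
Implicit Types (F G D E : diffop K).

(** The native product of polynomials only places coefficients here: this is d^2 + d F1 + F0. *)
Definition order2 (F0 F1 : 'M[{poly K}]_2) : diffop K :=
  'X^2 + F1%:P * 'X + F0%:P.

Variables (F0 F1 : 'M[{poly K}]_2).
Hypothesis dF0 : deriv_mx F0 = 0.
Hypothesis ddF1 : deriv_mx (deriv_mx F1) = 0.
Let D := order2 F0 F1.

Lemma size_order2 : size D = 3.
Proof.
rewrite /D /order2 -addrA size_polyDl size_polyXn//.
by rewrite size_MXaddC; case: ifP => // _; rewrite !ltnS size_polyC_leq1.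
Qed.

Lemma coef_order2 k :
  D`_k = if k is k'.+1 then if k' is k''.+1 then (k'' == 0)%:R else F1 else F0.
Proof.
rewrite /D /order2 !coefD coefXn coefMX !coefC.
by case: k => [|[|k]] /=; rewrite ?add0r ?addr0 ?eqSS.
Qed.

Lemma map_deriv_mxMXn E k :
  map_poly (@deriv_mx K) (E * 'X^k) = map_poly (@deriv_mx K) E * 'X^k.
Proof.
apply/polyP => m; rewrite coef_map !coefMXn coef_map.
by case: ifP => // _; rewrite raddf0.
Qed.

Lemma deriv_mx1 : deriv_mx 1 = 0 :> 'M[{poly K}]_2.
Proof.
apply: (addIr (deriv_mx 1)); rewrite add0r.
by have := deriv_mxM (1 : 'M[{poly K}]_2) 1; rewrite !mul1mx !mulmx1.
Qed.

(** By F d = d F + F', one passage of d adds d F1', since F0' = 0; as F1'' = 0, every later passage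
    adds the same term, whence the factor k. *)
Lemma iter_mul_partial_order2 k :
  iter k (@mul_partial K) D = D * 'X^k + (deriv_mx F1)%:P * 'X^k *+ k.
Proof.
have mapD : map_poly (@deriv_mx K) D = (deriv_mx F1)%:P * 'X.
  apply/polyP => m; rewrite coef_map coef_order2 coefMX coefC.
  by case: m => [|[|[|m]]] //=; rewrite ?deriv_mx1 ?raddf0.
elim: k => [|k IHk] /=; first by rewrite expr0 mulr1 mulr0n addr0.
rewrite IHk /mul_partial raddfD raddfMn /= !map_deriv_mxMXn mapD map_polyC /=.
by rewrite ddF1 mul0r mul0rn addr0 mulrDl mulrnAl -!mulrA -exprSr -exprS mulrSr addrA.
Qed.

Lemma coef_opmul_order2l E m :
  (opmul D E)`_m = (D * E)`_m + deriv_mx F1 *m E`_m *+ m.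
Proof.
have -> : opmul D E =
    D * E + (deriv_mx F1)%:P * \poly_(j < size E) (E`_j *+ j).
  have {1}-> : D * E = D * \sum_(j < size E) E`_j *: 'X^j.
    by rewrite -poly_def coefK.
  rewrite poly_def /opmul !mulr_sumr -big_split; apply: eq_bigr => j _ /=.
  rewrite iter_mul_partial_order2 mulrDl -mulrA -commr_polyXn -mul_polyC.
  by rewrite -scalerMnl -mul_polyC mulrnAl mulrnAr -!mulrA commr_polyXn.
rewrite coefD coefCM coef_poly; congr (_ + _); case: ltnP => [_|le_m].
  by rewrite mulrnAr.
by rewrite nth_default// mulmx0 mul0rn mulr0.
Qed.

Lemma coef_opmul_order2r E m :
  (opmul E D)`_m = E`_m *m F0 + (mul_partial E)`_m *m F1
                   + (mul_partial (mul_partial E))`_m.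
Proof.
rewrite /opmul size_order2 !big_ord_recl big_ord0 !coef_order2 /= addr0.
by rewrite 2!coefD !coefMC addrA mulr1.
Qed.

Lemma coef_mul_partialS E m :
  (mul_partial E)`_m.+1 = E`_m + deriv_mx E`_m.+1.
Proof. by rewrite coefD coefMX coef_map. Qed.

Lemma coef_order2_mulS E m :
  (D * E)`_m.+1 = (E * 'X)`_m + F1 *m E`_m + F0 *m E`_m.+1.
Proof.
rewrite /D /order2 !mulrDl !coefD coefXnM -[F1%:P * _ * _]mulrA !coefCM coefXM.
by rewrite coefMX subSS; case: m => [|m] //=; rewrite subn1.
Qed.
End CoefficientOfCommutator.
End MatrixPolynomials.

(** * The commutant of the operator *)

Section CommutantOfDiagonal.
Variable K : numDomainType.
Variables (f0 f1 : {poly K}) (k0 k1 e : K).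
Hypothesis e_neq0 : e != 0.
Hypothesis f01 : f0 - f1 = e%:P.
Hypothesis ddf0 : f0^`()^`() = 0.
Notation F0 := (mx2 k0%:P 0 0 k1%:P).
Notation F1 := (mx2 f0 0 0 f1).

(** Going down from the top, an off-diagonal coefficient h of E satisfies c h = 2 h' with c = e or c
    = -e; as c is nonzero and h' has smaller degree than a nonzero h, this forces h = 0. *)
Lemma commutant_diagonal (E : diffop K) :
  opmul E (order2 F0 F1) = opmul (order2 F0 F1) E ->
  forall m, E`_m 0 1 = 0 /\ E`_m 1 0 = 0.
Proof.
have f1E : f1 = f0 - e%:P by rewrite -f01 opprB addrC subrK.
have dF0 : deriv_mx F0 = 0.
  by apply: eq_mx2; rewrite !mxE /= ?derivC ?deriv0.
have dF1 : deriv_mx F1 = (f0^`())%:M.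
  by apply: eq_mx2; rewrite !mxE /= ?deriv0// f1E derivB derivC subr0.
have ddF1 : deriv_mx (deriv_mx F1) = 0.
  by rewrite dF1; apply: eq_mx2; rewrite !mxE /= ?mulr0n ?mulr1n ?deriv0.
move=> comm.
have zero (c : K) (p : {poly K}) : c != 0 -> c%:P * p = p^`() *+ 2 -> p = 0.
  move=> c0 cp; apply/eqP/negPn/negP => p0.
  have : (size (c%:P * p)%R < size p)%N.
    rewrite cp -scaler_nat (leq_ltn_trans (size_scale_leq _ _))// lt_size_deriv//.
  by rewrite mul_polyC size_scale// ltnn.
(* The coefficient of d^(m+1) in the commutator is (f_i - f_j) e_m - 2 e_m' at
   the off-diagonal position (i, j), once e_(m+1) = 0 there. *)
have step m : E`_m.+1 0 1 = 0 /\ E`_m.+1 1 0 = 0 -> E`_m 0 1 = 0 /\ E`_m 1 0 = 0.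
  move=> [h01 h10].
  have : (opmul E (order2 F0 F1))`_m.+1 = (opmul (order2 F0 F1) E)`_m.+1.
    by rewrite comm.
  rewrite (coef_opmul_order2l dF0 ddF1) coef_opmul_order2r.
  rewrite coef_order2_mulS !coef_mul_partialS [(mul_partial E)`_m]coefD coef_map.
  rewrite dF1 raddfD /=.
  (* [X] stands for the coefficient of index m - 1, or 0 when m = 0; it occurs on both sides and
     cancels. *)
  move: (E`_m.+1) (E`_m) (E * 'X)`_m h01 h10 => G H X h01 h10 eqm.
  have := congr1 (fun M : 'M[{poly K}]_2 => M 0 1) eqm.
  have := congr1 (fun M : 'M[{poly K}]_2 => M 1 0) eqm.
  rewrite !(mulmx2E, mulmxnE, mxE) /= h01 h10 !deriv0 !mulr0n !mulr1n f1E.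
  rewrite !(mul0r, mulr0, add0r, addr0, mul0rn) => eq10 eq01.
  split; [apply: (zero e) | apply: (zero (- e))]; rewrite ?oppr_eq0//.
    set d := (_^`()); have -> : e%:P * H 0 1 = X 0 1 + f0 * H 0 1
        - (H 0 1 * (f0 - e%:P) + (X 0 1 + d + d)) + d *+ 2 by ring.
    by rewrite eq01 subrr add0r.
  set d := (_^`()); have -> : (- e)%:P * H 1 0 = X 1 0 + (f0 - e%:P) * H 1 0
      - (H 1 0 * f0 + (X 1 0 + d + d)) + d *+ 2 by rewrite polyCN; ring.
  by rewrite eq10 subrr add0r.
(* Downward induction from the index [size E], where the coefficient is the default 0; once index 0
   is reached, truncated subtraction stays there. *)
move=> m; have : forall k, E`_(size E - k) 0 1 = 0 /\ E`_(size E - k) 1 0 = 0.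
  elim=> [|k IHk]; first by rewrite subn0 nth_default ?mxE.
  have [lt_k|le_k] := ltnP k (size E); last first.
    by move: IHk; rewrite (eqP le_k) subnS (eqP le_k).
  by apply: step; rewrite -subSn// subSS.
move/(_ (size E - m)%N); have [le_m|lt_m] := leqP m (size E).
  by rewrite subKn.
by move=> _; rewrite nth_default ?mxE // ltnW.
Qed.
End CommutantOfDiagonal.

(** * Matrix polynomials expanded in a monic sequence *)

Section MonicSequences.
Variable K : comNzRingType.
Variable P : nat -> 'M[{poly K}]_2.
Hypothesis sizeP : forall n, mxsize_le n.+1 (P n).
Hypothesis leadP : forall n, mxcoef n (P n) = 1.

(** Subtracting the leading coefficient times the monic term of the same degree lowers the degree,
    so Q is a combination of the [P n], n < m, with constant left factors. *)
Lemma monic_seq_ind (S : 'M[{poly K}]_2 -> Prop) m :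
  S 0 -> (forall Q Q', S Q -> S Q' -> S (Q + Q')) ->
  (forall A n, (n < m)%N -> S (map_mx polyC A *m P n)) ->
  forall Q, mxsize_le m Q -> S Q.
Proof.
move=> S0 SD; elim: m => [_ Q szQ|m IHm SP Q szQ].
  suff -> : Q = 0 by [].
  apply/matrixP => i j; apply/eqP; rewrite mxE -size_poly_eq0 -leqn0; exact: szQ.
pose Q' := map_mx polyC (mxcoef m Q) *m P m.
rewrite -(subrK Q' Q); apply: SD; last exact: SP.
apply: IHm => [A n lt_n|]; first by apply: SP; rewrite ltnS ltnW.
apply/mxsize_leP => k; rewrite leq_eqVlt => /predU1P[<-|lt_k].
  by rewrite mxcoefB mxcoef_mul leadP mulmx1 subrr.
rewrite mxcoefB mxcoef_mul (mxsize_leP m.+1 Q).1// (mxsize_leP m.+1 (P m)).1//.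
by rewrite mulmx0 subrr.
Qed.

Variables (E : diffop K) (L : nat -> 'M[K]_2).
Hypothesis actP : forall n, act (P n) E = map_mx polyC (L n) *m P n.

Lemma mxsize_act m Q : mxsize_le m Q -> mxsize_le m (act Q E).
Proof.
apply: (monic_seq_ind (S := fun Q => mxsize_le m (act Q E))) => [|Q1 Q2|A n lt_n].
- by rewrite act0l => i j; rewrite mxE size_poly0.
- move=> /mxsize_leP h1 /mxsize_leP h2; rewrite actDl; apply/mxsize_leP => k le_k.
  by rewrite mxcoefD h1// h2// addr0.
- rewrite actMl actP mulmxA; apply/mxsize_leP => k le_k.
  rewrite -map_mxM mxcoef_mul (mxsize_leP n.+1 (P n)).1 ?mulmx0//.
  exact: leq_trans le_k.
Qed.

(** In the expansion of Q in the [P n], only the term of [P m] reaches x^m. This lets [L m] be read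
    off from test polynomials other than [P m], such as x^m I. *)
Lemma mxcoef_act m Q :
  mxsize_le m.+1 Q -> mxcoef m (act Q E) = mxcoef m Q *m L m.
Proof.
apply: (monic_seq_ind (S := fun Q => mxcoef m (act Q E) = mxcoef m Q *m L m))
    => [|Q1 Q2 h1 h2|A n].
- by rewrite act0l; apply/matrixP => i j; rewrite mxcoefE mulmx2E !mxE coef0 !mul0r addr0.
- by rewrite actDl !mxcoefD h1 h2 mulmxDl.
- rewrite actMl actP mulmxA -map_mxM !mxcoef_mul ltnS leq_eqVlt => /predU1P[->|lt_n].
    by rewrite leadP !mulmx1.
  by rewrite (mxsize_leP n.+1 (P n)).1// !mulmx0 mul0mx.
Qed.

End MonicSequences.

(** * Values of scalar polynomials at an operator *)

Section OperatorPolynomials.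
Variable K : comNzRingType.

Lemma act1 Q : act Q (1 : diffop K) = Q.
Proof. by rewrite act_polyC mulmx1. Qed.

Lemma act_opscale (c : K) Q D : act Q (opscale c D) = (c%:P)%:M *m act Q D.
Proof.
rewrite (@act_widen _ _ _ (size D)); last first.
  by apply/leq_sizeP => j le_j; rewrite coefZ nth_default ?mulr0.
rewrite /act mulmx_sumr; apply: eq_bigr => j _.
by rewrite coefZ -[_ * _]/(_ *m _) !mulmxA scalar_mxC.
Qed.

(** Constant left factors pass through the action, so each further D contributes one more factor
    A. *)
Lemma act_op_horner (p : {poly K}) Q D (A : 'M[K]_2) :
  act Q D = map_mx polyC A *m Q ->
  act Q (op_horner p D) = map_mx polyC (\sum_(k < size p) p`_k *: A ^+ k) *m Q.
Proof.
move=> actQ; have actX k : act Q (opexp D k) = map_mx polyC (A ^+ k) *m Q.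
  elim: k => [|k IHk].
    by rewrite act1 expr0 map_mx1 mul1mx.
  rewrite /= act_opmul actQ actMl IHk mulmxA exprS.
  by rewrite -[A * _]/(A *m _) map_mxM.
rewrite /op_horner (big_morph (act Q) (@actD K Q) (@act0 K Q)).
rewrite raddf_sum mulmx_suml; apply: eq_bigr => k _.
by rewrite act_opscale actX /= map_mxZ mulmxA mul_scalar_mx.
Qed.

End OperatorPolynomials.

Lemma act_order2 (K : comNzRingType) (F0 F1 P : 'M[{poly K}]_2) :
  act P (order2 F0 F1) = P *m F0 + deriv_mx P *m F1 + deriv_mx (deriv_mx P).
Proof.
rewrite /act size_order2 !big_ord_recl big_ord0 !coef_order2 /= addr0.
by rewrite addrA mulmx1.
Qed.

(** Serves to show that eigenvalues are polynomial in n: falling factorials arise from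
    differentiating x^n. *)
Lemma ffact_horner (K : comNzRingType) k n :
  (\prod_(i < k) ('X - (i%:R)%:P : {poly K})).[n%:R] = (n ^_ k)%:R.
Proof.
elim: k => [|k IHk]; first by rewrite big_ord0 hornerC ffactn0.
rewrite big_ord_recr hornerM IHk /= hornerXsubC ffactnSr natrM.
(* [natrB] covers k <= n only; for n < k the falling factorial is already 0. *)
have [le_k|lt_n] := leqP k n; first by rewrite natrB.
by rewrite ffact_small// !mul0r.
Qed.

(** * Diagonalizing D by the matrix T *)

Section Commutant.
Variable K : numFieldType.
Variables a b : K.
Implicit Types (P Q : 'M[{poly K}]_2) (E : diffop K).

Definition hermite_op : diffop K :=
  order2 (mx2 (- 2)%:P 0 0 0)
    (mx2 (- 2 *: 'X + (2 * b)%:P) (- (2 * a * b) *: 'X + (2 * a)%:P)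
         0                        (- 2 *: 'X)).

(** The entry [0%:P], rather than [0], is the form that [commutant_diagonal] takes for [k1 = 0]. *)
Definition hermite_diag : diffop K :=
  order2 (mx2 (- 2)%:P 0 0 0%:P)
    (mx2 (- 2 *: 'X + (2 * b)%:P) 0 0 (- 2 *: 'X)).

Definition triang : 'M[{poly K}]_2 := mx2 1 (a *: 'X) 0 1.
Definition triangV : 'M[{poly K}]_2 := mx2 1 (- a *: 'X) 0 1.

Lemma triangK : triang *m triangV = 1%:M.
Proof.
by apply: eq_mx2; rewrite mulmx2E !mx2E !mxE /= ?scaleNr; ring.
Qed.

Lemma triangVK : triangV *m triang = 1%:M.
Proof.
by apply: eq_mx2; rewrite mulmx2E !mx2E !mxE /= ?scaleNr; ring.
Qed.

Lemma act_hermite_triang P :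
  act P hermite_op *m triang = act (P *m triang) hermite_diag.
Proof.
rewrite !act_order2 !deriv_mxM.
have dT : deriv_mx triang = mx2 0 a%:P 0 0.
  by apply: eq_mx2; rewrite !mxE /= ?derivZ ?derivX ?alg_polyC -?polyC1 ?derivC ?deriv0.
have ddT : deriv_mx (mx2 0 a%:P 0 0) = 0.
  by apply: eq_mx2; rewrite !mxE /= ?derivC ?deriv0.
rewrite (raddfD (@deriv_mx K) : {morph @deriv_mx K : x y / x + y}) !deriv_mxM dT ddT.
(* P, P' and P'' become independent matrices; the relation holds identically in them. *)
move: (deriv_mx (deriv_mx P)) (deriv_mx P) => P2 P1.
by apply: eq_mx2; rewrite !(mulmx2E, mxE) /= -!mul_polyC
  !(polyCN, polyCM, polyC_natr, polyC0); ring.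
Qed.

Definition hermite_eigen n : 'M[K]_2 :=
  mx2 (- 2 * n.+1%:R) (- (2 * a * b) * n%:R) 0 (- 2 * n%:R).

Lemma coefX_deriv (p : {poly K}) m : ('X * p^`())`_m = p`_m *+ m.
Proof. by rewrite coefXM coef_deriv; case: m. Qed.

(** Q'' and Q' times the constant part of F1 only produce powers below x^m, while x Q' multiplies
    the coefficient of x^m by m. *)
Lemma mxcoef_hermite m Q : mxsize_le m.+1 Q ->
  mxcoef m (act Q hermite_op) = mxcoef m Q *m hermite_eigen m.
Proof.
move=> szQ; have Q0 k : (m < k)%N -> mxcoef k Q = 0.
  exact: ((mxsize_leP _ _).1 szQ).
rewrite act_order2 !mxcoefD mxcoef_deriv mxcoef_deriv (Q0 m.+2)// !mul0rn addr0.
have Q1 i j : ((Q i j)^`())`_m = 0.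
  by rewrite coef_deriv -mxcoefE (Q0 m.+1)// mxE mul0rn.
have QX i j (c : K) : ((Q i j)^`() * (c *: 'X))`_m = (Q i j)`_m * c * m%:R.
  by rewrite -scalerAr coefZ [_ * 'X]mulrC coefX_deriv -[_ *+ m]mulr_natr; ring.
have QXC i j (c d : K) : ((Q i j)^`() * (c *: 'X + d%:P))`_m = (Q i j)`_m * c * m%:R.
  by rewrite mulrDr coefD QX coefMC Q1 mul0r addr0.
have dQ i j : deriv_mx Q i j = (Q i j)^`() by rewrite mxE.
apply: eq_mx2; rewrite !mxE !sum_ord2 !coefD !dQ !mx2E !mulr0 !mxcoefE.
- by rewrite QXC coefMC coef0 -natr1; ring.
- by rewrite QXC QX coef0; ring.
- by rewrite QXC coefMC coef0 -natr1; ring.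
- by rewrite QXC QX coef0; ring.
Qed.

Lemma mxsize_hermite m Q : mxsize_le m Q -> mxsize_le m (act Q hermite_op).
Proof.
move=> /mxsize_leP Q0; apply/mxsize_leP => k le_k.
rewrite mxcoef_hermite ?Q0 ?mul0mx//; apply/mxsize_leP => l lt_l.
by rewrite Q0// (leq_trans le_k)// ltnW.
Qed.

(** The off-diagonal entry is -2abn times the divided difference of x^k at the two eigenvalues,
    whose gap is -2. *)
Lemma hermite_eigenX n k : hermite_eigen n ^+ k =
  mx2 ((- 2 * n.+1%:R) ^+ k)
      (a * b * n%:R * ((- 2 * n.+1%:R) ^+ k - (- 2 * n%:R) ^+ k)) 0
      ((- 2 * n%:R) ^+ k).
Proof.
elim: k => [|k IHk]; first by apply: eq_mx2; rewrite !mxE /= ?subrr ?mulr0.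
rewrite exprS IHk -[_ * _]/(_ *m _); apply: eq_mx2; rewrite mulmx2E !mx2E ?exprS.
all: rewrite -?[n.+1%:R]natr1; ring.
Qed.

Hypotheses (a_neq0 : a != 0) (b_neq0 : b != 0).

(** As operators act on the right, the left factor applies first; this is T^-1 E T. *)
Definition conj_triang E : diffop K := opmul triangV%:P (opmul E triang%:P).

Lemma act_conj_triang Q E : act (Q *m triang) (conj_triang E) = act Q E *m triang.
Proof.
by rewrite !act_opmul !act_polyC -mulmxA triangK mulmx1.
Qed.

Lemma conj_triang_diagonal E :
  opmul E hermite_op = opmul hermite_op E ->
  forall m, (conj_triang E)`_m 0 1 = 0 /\ (conj_triang E)`_m 1 0 = 0.
Proof.
move=> comm; have b2 : 2 * b != 0 by rewrite mulf_neq0// pnatr_eq0.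
apply: (@commutant_diagonal _ (- 2 *: 'X + (2 * b)%:P) (- 2 *: 'X) (- 2) 0 _ b2).
- by rewrite addrAC subrr add0r.
- by rewrite derivD derivZ derivX derivC addr0 derivZ -polyC1 derivC scaler0.
apply: act_inj => Q; rewrite -/hermite_diag act_opmul [RHS]act_opmul.
(* Every Q is of the form Q' T, so both intertwining relations apply to it. *)
have -> : Q = Q *m triangV *m triang by rewrite -mulmxA triangVK mulmx1.
rewrite act_conj_triang -!act_hermite_triang act_conj_triang.
by rewrite -!act_opmul comm.
Qed.

Definition act_entry E (j : 'I_2) (p : {poly K}) : {poly K} :=
  \sum_(k < size E) p^`(k) * E`_k j j.

Lemma iter_deriv_mxE k Q i j : iter k (@deriv_mx K) Q i j = (Q i j)^`(k).
Proof. by elim: k => //= k IHk; rewrite mxE IHk. Qed.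

Lemma act_diagonal E Q i j : (forall m, E`_m 0 1 = 0 /\ E`_m 1 0 = 0) ->
  act Q E i j = act_entry E j (Q i j).
Proof.
move=> dE; rewrite summxE; apply: eq_bigr => k _.
rewrite mulmx2E !iter_deriv_mxE; have [E01 E10] := dE k.
have [->|->] := ord2_eq j.
- by rewrite E10 mulr0 addr0.
- by rewrite E01 mulr0 add0r.
Qed.

Lemma act_entryZ E j c p : act_entry E j (c *: p) = c *: act_entry E j p.
Proof.
rewrite /act_entry scaler_sumr; apply: eq_bigr => k _.
by rewrite derivnZ scalerAl.
Qed.

Lemma act_entry0 E j : act_entry E j 0 = 0.
Proof. by rewrite -[X in act_entry E j X](scale0r 0) act_entryZ scale0r. Qed.

(** d^k sends x^n to a falling factorial times x^(n-k), so only the x^k part of the k-th coefficient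
    of E leads back to x^n. *)
Lemma mxcoef_actXn E n : mxcoef n (act ('X^n)%:M E) =
  \sum_(k < size E) mxcoef k E`_k *+ n ^_ k.
Proof.
have mxcoef0 : mxcoef n 0 = 0 :> 'M[K]_2.
  by apply/matrixP => i j; rewrite mxcoefE !mxE coef0.
rewrite /act (big_morph (mxcoef n) (@mxcoefD K n) mxcoef0).
apply: eq_bigr => k _.
have -> : iter k (@deriv_mx K) ('X^n)%:M = ('X^(n - k) *+ n ^_ k)%:M.
  apply/matrixP => i j; rewrite iter_deriv_mxE !mxE.
  by case: eqP => _; rewrite ?mulr1n ?mulr0n ?derivn0 ?derivnXn ?linear0.
rewrite mul_scalar_mx; apply/matrixP => i j; rewrite mulmxnE !mxE mulrnAl coefMn.
have [le_k|lt_n] := leqP k n; last by rewrite ffact_small// !mulr0n.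
by rewrite coefXnM ltnNge leq_subr /= subKn.
Qed.

(** * Eigenvalues of an operator commuting with D *)

Section InDW.
Variable P : nat -> 'M[{poly K}]_2.
Hypothesis sizeP : forall n, mxsize_le n.+1 (P n).
Hypothesis leadP : forall n, mxcoef n (P n) = 1.
Hypothesis hermiteP :
  forall n, act (P n) hermite_op = map_mx polyC (hermite_eigen n) *m P n.
Variables (E : diffop K) (L : nat -> 'M[K]_2).
Hypothesis actP : forall n, act (P n) E = map_mx polyC (L n) *m P n.
Hypothesis comm : opmul E hermite_op = opmul hermite_op E.

Lemma eigen_comm n : L n *m hermite_eigen n = hermite_eigen n *m L n.
Proof.
have: mxcoef n (act (P n) (opmul E hermite_op)) =
      mxcoef n (act (P n) (opmul hermite_op E)) by rewrite comm.
by rewrite !act_opmul actP hermiteP !actMl actP hermiteP !mxcoef_mul leadP !mulmx1.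
Qed.

(** The diagonal entries of the upper triangular Lambda_n differ by 2, so a matrix commuting with it
    is upper triangular. *)
Lemma eigen10 n : L n 1 0 = 0.
Proof.
have := congr1 (fun M : 'M[_]_2 => M 1 0) (eigen_comm n).
rewrite !mulmx2E !mx2E mulr0 addr0 mul0r add0r -natr1 => /eqP.
rewrite -subr_eq0 (_ : _ - _ = - 2 * L n 1 0); last by ring.
by rewrite mulf_eq0 oppr_eq0 pnatr_eq0 => /eqP.
Qed.

(** The same gap 2 determines the remaining entry from the diagonal. *)
Lemma eigen01 n : L n 0 1 = a * b * n%:R * (L n 0 0 - L n 1 1).
Proof.
have := congr1 (fun M : 'M[_]_2 => M 0 1) (eigen_comm n).
rewrite !mulmx2E !mx2E -natr1 => /eqP; rewrite -subr_eq0 => /eqP eq0.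
have /eqP : 2 * (L n 0 1 - a * b * n%:R * (L n 0 0 - L n 1 1)) = 0.
  by rewrite -eq0; ring.
by rewrite mulf_eq0 pnatr_eq0 subr_eq0 => /eqP.
Qed.

(* Compare the coefficients of x^(n+1) in the (0, 1) entry of
   (x^n I) E T = (x^n T) E'. *)
Lemma eigen_shift n : L n 0 0 = L n.+1 1 1.
Proof.
have dE := conj_triang_diagonal comm.
have szX m : mxsize_le m.+1 (('X^m)%:M : 'M[{poly K}]_2).
  move=> i j; rewrite !mxE; case: eqP => _; first by rewrite mulr1n size_polyXn.
  by rewrite mulr0n size_poly0.
have coX m : mxcoef m (('X^m)%:M : 'M[{poly K}]_2) = 1.
  by apply/matrixP => i j; rewrite !mxE coefMn coefXn eqxx.
have coA m i j : (act ('X^m)%:M E i j)`_m = L m i j.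
  by rewrite -mxcoefE (mxcoef_act sizeP leadP actP)// coX mul1mx.
have coA' m i j k : (m < k)%N -> (act ('X^m)%:M E i j)`_k = 0.
  move=> lt_k; rewrite -mxcoefE ((mxsize_leP m.+1 _).1 _ k lt_k) ?mxE//.
  exact: (mxsize_act sizeP leadP actP).
have entry m i j := congr1 (fun M : 'M[_]_2 => M i j) (act_conj_triang ('X^m)%:M E).
(* The second row of x^m T is (0, x^m) and E' is diagonal, so the image of this row has first entry
   0. *)
have e10 m : act ('X^m)%:M E 1 0 = 0.
  have := entry m 1 0; rewrite (act_diagonal _ _ _ dE) !mulmx2E !mx2E !mxE /=.
  by rewrite mulr0n mul0r !mulr0 addr0 act_entry0 mulr1 addr0.
have e11 m : act_entry (conj_triang E) 1 'X^m = act ('X^m)%:M E 1 1.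
  have := entry m 1 1; rewrite (act_diagonal _ _ _ dE) !mulmx2E !mx2E e10 mul0r.
  by rewrite !mxE /= mulr0n mul0r !add0r mulr1n !mulr1.
have := entry n 0 1; rewrite (act_diagonal _ _ _ dE) !mulmx2E !mx2E.
rewrite !(mxE _ _ 0) /= mulr1n mulr0n mul0r addr0 -scalerAr -exprSr act_entryZ e11.
(* The [(0, 1)] entry of x^n E has degree at most n, so a t_(n+1) = a s_n remains, and a is
   nonzero. *)
move/(congr1 (fun p : {poly K} => p`_n.+1)).
rewrite coefD mulr1 -scalerAr !coefZ coefMX !coA coA'// addr0.
by move/(mulfI a_neq0).
Qed.

(** t_n is the coefficient of x^n in the [(1, 1)] entry of x^n E, a combination of falling
    factorials of n. *)
Lemma eigen_poly : exists p : {poly K}, forall n, L n 1 1 = p.[- 2 * n%:R].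
Proof.
pose q := \sum_(k < size E) (E`_k 1 1)`_k *: \prod_(i < k) ('X - (i%:R)%:P).
(* Composition with -X/2 recovers n from the eigenvalue -2n. *)
exists (q \Po (- 2^-1 *: 'X)) => n.
have -> : (q \Po (- 2^-1 *: 'X)).[- 2 * n%:R] = q.[n%:R].
  rewrite horner_comp hornerZ hornerX; congr (q.[_]).
  by rewrite mulrA mulrNN mulVf ?mul1r// pnatr_eq0.
rewrite /q horner_sum -[L n]mul1mx.
have szX : mxsize_le n.+1 (('X^n)%:M : 'M[{poly K}]_2).
  by move=> i j; rewrite mxE; case: eqP; rewrite ?mulr1n ?mulr0n ?size_polyXn ?size_poly0.
have <- : mxcoef n ('X^n)%:M = 1%:M :> 'M[K]_2.
  by apply/matrixP => i j; rewrite !mxE coefMn coefXn eqxx.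
rewrite -(mxcoef_act sizeP leadP actP szX) mxcoef_actXn summxE.
by apply: eq_bigr => k _; rewrite mulmxnE mxE hornerZ ffact_horner mulr_natr.
Qed.

(** It is enough to compare the actions on the [P n]: these are left multiplications by L_n and
    p(Lambda_n), which agree entry by entry. *)
Lemma commutant_hermite : exists p : {poly K}, E = op_horner p hermite_op.
Proof.
have [p Lp] := eigen_poly; exists p; apply: act_inj => Q.
pose m := \max_i \max_j size (Q i j).
have szQ : mxsize_le m Q.
  move=> i j; apply: leq_trans (leq_bigmax (F := fun i => \max_j size (Q i j)) i).
  exact: (leq_bigmax (F := fun j => size (Q i j))).
move: m szQ => m; move: Q; apply: (monic_seq_ind sizeP leadP
  (S := fun Q => act Q E = act Q (op_horner p hermite_op))) => [|Q1 Q2 h1 h2|A n _].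
- by rewrite !act0l.
- by rewrite !actDl h1 h2.
rewrite !actMl actP (act_op_horner p (hermiteP n)); congr (_ *m (map_mx _ _ *m _)).
under eq_bigr do rewrite hermite_eigenX.
apply: eq_mx2; rewrite summxE.
- by rewrite eigen_shift Lp horner_coef; apply: eq_bigr => k _; rewrite mxE mx2E.
(* Both sides are abn (p(-2(n+1)) - p(-2n)), by [hermite_eigenX] summed over the powers. *)
- rewrite eigen01 eigen_shift !Lp !horner_coef -sumrB mulr_sumr.
  by apply: eq_bigr => k _; rewrite mxE mx2E; ring.
- by rewrite eigen10 big1// => k _; rewrite mxE mx2E mulr0.
- by rewrite Lp horner_coef; apply: eq_bigr => k _; rewrite mxE mx2E.
Qed.
End InDW.
End Commutant.

(** * Gaussian integrals of polynomials *)

Section GaussianFunctional.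
Import numFieldNormedType.Exports.
Local Open Scope classical_set_scope.
Variable R : realType.
Implicit Types (c x : R) (r s : {poly R}).
Notation mu := (@lebesgue_measure R).

(** The parameters [c = b] and [c = 0] give the two entries of the diagonalized weight. *)
Definition gauss_weight c x : R := expR (- x ^+ 2 + 2 * c * x).

Definition gauss_integral c r : R := \int[mu]_x (r.[x] * gauss_weight c x).

(** For y >= 0 the term y^n / n! of the exponential series is at most e^y; adding e^x and e^-x
    covers both signs. *)
Lemma expr_le_expR n x : `|x| ^+ n <= n`!%:R * (expR x + expR (- x)).
Proof.
have H (y : R) : 0 <= y -> y ^+ n <= n`!%:R * expR y.
  move=> y0; case: n => [|n].
    by rewrite expr0 fact0 mul1r (le_trans _ (expR_ge1Dx y))// lerDl.
  have yn : y ^+ n.+1 / n.+1`!%:R <= expR y.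
    by rewrite (le_trans _ (expR_ge1Dxn n y0))// lerDr ler01.
  by move: yn; rewrite ler_pdivrMr ?ltr0n ?fact_gt0// mulrC.
have [x0|x0] := leP 0 x.
  rewrite ger0_norm// (le_trans (H x x0))// ler_wpM2l ?ler0n// lerDl expR_ge0//.
rewrite ltr0_norm// (le_trans (H (- x) _)) ?oppr_ge0 ?(ltW x0)//.
by rewrite ler_wpM2l ?ler0n// lerDr expR_ge0.
Qed.

(** Since (x - 2c)^2 >= 0, the exponent is at most 2c^2 - x^2/2; dividing by the peak of the density
    gives the constant. *)
Lemma gauss_weight_le_normal c : exists K, 0 <= K /\
  forall x, gauss_weight c x <= K * normal_pdf 0 1 x.
Proof.
pose p : R := normal_peak 1.
have p0 : 0 < p by rewrite normal_peak_gt0 ?oner_neq0.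
exists (expR (2 * c ^+ 2) / p); split.
  by rewrite divr_ge0 ?expR_ge0 ?ltW.
move=> x; rewrite normal_pdfE ?oner_neq0// -/p mulrA divfK ?gt_eqF//.
rewrite /gauss_weight /normal_fun -expRD ler_expR subr0 expr1n.
have := sqr_ge0 (x - 2 * c); lra.
Qed.

(** The density on the right is integrable and bounded: this yields integrability and, applied to x
    r, decay at infinity. *)
Lemma gauss_bound c r : exists K,
  forall x, `|r.[x] * gauss_weight c x| <= K * normal_pdf 0 1 x.
Proof.
have monb n : exists K, forall x, `|x| ^+ n * gauss_weight c x <= K * normal_pdf 0 1 x.
  (* Multiplying the weight by e^x or e^-x replaces c by c + 1/2 or c - 1/2. *)
  have [K1 [K10 H1]] := gauss_weight_le_normal (c + 2^-1).
  have [K2 [K20 H2]] := gauss_weight_le_normal (c - 2^-1).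
  exists (n`!%:R * (K1 + K2)) => x.
  apply: (@le_trans _ _ (n`!%:R * (expR x + expR (- x)) * gauss_weight c x)).
    by rewrite ler_wpM2r ?expR_ge0 ?expr_le_expR.
  rewrite -!mulrA ler_wpM2l ?ler0n// !mulrDl lerD//.
    rewrite (le_trans _ (H1 x))// /gauss_weight -expRD ler_expR; lra.
  rewrite (le_trans _ (H2 x))// /gauss_weight -expRD ler_expR; lra.
rewrite -[r]coefK poly_def; elim/big_rec: _ => [|i q _ [K HK]].
  by exists 0 => x; rewrite horner0 !mul0r normr0.
have [K' HK'] := monb i.
exists (`|r`_i| * K' + K) => x.
rewrite hornerD hornerZ hornerXn mulrDl mulrDl (le_trans (ler_normD _ _))//.
rewrite lerD// -!mulrA normrM ler_wpM2l ?normr_ge0//.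
by rewrite normrM normrX [X in _ * X]ger0_norm ?expR_ge0.
Qed.

Lemma continuous_gauss_weight c : continuous (gauss_weight c).
Proof.
move=> x; apply: continuous_comp; last exact: continuous_expR.
apply: cvgD; first by apply: cvgN; exact: exprn_continuous.
by apply: cvgM; [exact: cvg_cst|exact: cvg_id].
Qed.

Lemma continuous_gauss c r : continuous (fun x => r.[x] * gauss_weight c x).
Proof.
move=> x; apply: cvgM; first exact: continuous_horner.
exact: continuous_gauss_weight.
Qed.

Lemma integrable_gauss c r :
  mu.-integrable setT (fun x => (r.[x] * gauss_weight c x)%:E).
Proof.
have [K HK] := gauss_bound c r.
apply: (@le_integrable _ _ _ mu setT measurableT _
  (fun x => (K%:E * (normal_pdf 0 1 x)%:E)%E)).
- apply/measurable_EFinP; exact: (continuous_measurable_fun (@continuous_gauss c r)).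
- move=> x _ /=; rewrite lee_fin (le_trans (HK x))// ler_norm//.
- exact: (integrableZl _ _ (@integrable_normal_pdf _ 0 1)).
Qed.

Lemma is_derive_gauss c r x :
  is_derive x 1 (fun y => r.[y] * gauss_weight c y)
    ((r^`() + ((2 * c)%:P - 2 *: 'X) * r).[x] * gauss_weight c x).
Proof.
have dh (q : {poly R}) : is_derive x 1 (horner q) (q^`()).[x].
  by rewrite derivE derive1E; apply: derivableP; exact: derivable_horner.
pose q : {poly R} := - 'X^2 + (2 * c) *: 'X.
have gE : gauss_weight c = expR \o horner q.
  by apply/funext => y; rewrite /gauss_weight /= !hornerE.
have dg : is_derive x 1 (gauss_weight c) (gauss_weight c x * (q^`()).[x]).
  rewrite gE; exact: is_derive1_comp.
have := is_deriveM (dh r) dg.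
rewrite (_ : _ + _ = (r^`() + ((2 * c)%:P - 2 *: 'X) * r).[x] * gauss_weight c x) //.
rewrite /q /GRing.scale /= derivD derivN derivXn derivZ derivX !hornerE /=.
ring.
Qed.

(** The integrand is the derivative of r times the weight, which tends to 0 at both ends; the
    fundamental theorem on [-(n+1), n+1] passes to the limit by dominated convergence. *)
Lemma gauss_integral_deriv c r :
  gauss_integral c (r^`() + ((2 * c)%:P - 2 *: 'X) * r) = 0.
Proof.
set s := (X in gauss_integral c X).
pose F x := r.[x] * gauss_weight c x; pose f x := s.[x] * gauss_weight c x.
have intf : mu.-integrable setT (EFin \o f) := integrable_gauss c s.
pose I n : set R := `[- (n.+1%:R : R), n.+1%:R]%classic.
have FTC n : (\int[mu]_(x in I n) (f x)%:E = (F n.+1%:R - F (- n.+1%:R))%:E)%E.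
  have lt_n : - n.+1%:R < n.+1%:R :> R.
    by rewrite -subr_gt0 opprK addr_gt0 ?ltr0n.
  rewrite (@continuous_FTC2 _ f F)// ?EFinB//.
  - exact/continuous_subspaceT/continuous_gauss.
  - split.
    + by move=> x _; have [] := is_derive_gauss c r x.
    + apply: cvg_at_right_filter; exact: continuous_gauss.
    + apply: cvg_at_left_filter; exact: continuous_gauss.
  - move=> x _; rewrite derive1E; exact: (@derive_val _ _ _ _ _ _ _ (is_derive_gauss c r x)).
(* x F(x) is bounded, so F vanishes at infinity. *)
have limF : F n.+1%:R - F (- n.+1%:R) @[n --> \oo] --> 0.
  have [K HK] := gauss_bound c ('X * r).
  pose M := `|K| * normal_peak 1.
  have HF x : `|x| * `|F x| <= M.
    have := HK x; rewrite hornerM hornerX -mulrA normrM => /le_trans -> //.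
    rewrite (le_trans (ler_wpM2r _ (ler_norm K))) ?normal_pdf_ge0//.
    by rewrite ler_wpM2l ?normr_ge0 ?normal_pdf_ub ?oner_neq0.
  have HF' (n : nat) : `|F n.+1%:R - F (- n.+1%:R)| <= 2 * M * n.+1%:R^-1.
    rewrite ler_pdivlMr ?ltr0n// mulrC.
    have h1 := HF n.+1%:R; have h2 := HF (- n.+1%:R).
    rewrite normrN (ger0_norm (ler0n R n.+1)) in h1 h2.
    apply: le_trans (ler_wpM2l _ (ler_normB _ _)) _; first exact: ler0n.
    by rewrite mulrDr (mulr_natl M) mulr2n lerD.
  have lim0 : 2 * M * n.+1%:R^-1 @[n --> \oo] --> 0.
    rewrite -[X in _ --> X](mulr0 (2 * M)).
    by apply: cvgM; [exact: cvg_cst | exact: cvg_harmonic].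
  apply/norm_cvg0P; apply: squeeze_cvgr (cvg_cst 0) lim0.
  by apply: nearW => n; rewrite normr_ge0 HF'.
have cvgI : (\int[mu]_x ((EFin \o f) \_ (I n)) x)%E @[n --> \oo] -->
    (\int[mu]_x (f x)%:E)%E.
  have [|||||//] := @dominated_convergence _ _ _ mu setT measurableT
    (fun n => (EFin \o f) \_ (I n)) (EFin \o f) (abse \o (EFin \o f)).
  - move=> n; have mI : measurable (I n) by exact: measurable_itv.
    apply: (measurable_restrictT (EFin \o f) mI).1.
    exact: (measurable_funS measurableT _ (measurable_int _ intf)).
  - exact: measurable_int intf.
  - apply: aeW => x _; apply: cvg_near_cst.
    near=> n; rewrite patchE mem_set//= /I/= in_itv/= -ler_norml.
    near: n; exists (Num.truncn `|x|) => // n /= le_n.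
    by rewrite (le_trans (ltW (truncnS_gt _)))// ler_nat ltnS.
  - exact: integrable_abse.
  - apply: aeW => x n _; rewrite patchE; case: ifP => // _.
    (* Outside [I n] the restriction takes the default value [point], which is 0 here. *)
    by rewrite (_ : point = 0%E)// abse0 abse_ge0.
have lim1 : (\int[mu]_x ((EFin \o f) \_ (I n)) x)%E @[n --> \oo] --> 0%:E.
  under eq_fun do rewrite -integral_mkcond FTC.
  by apply: cvg_EFin; [apply: nearW|exact: limF].
by rewrite /gauss_integral /Rintegral (cvg_unique _ cvgI lim1).
Unshelve. all: by end_near. Qed.

Lemma gauss_integralD c r s :
  gauss_integral c (r + s) = gauss_integral c r + gauss_integral c s.
Proof.
rewrite /gauss_integral -RintegralD//; [|exact: integrable_gauss..].
by apply: eq_Rintegral => x _; rewrite hornerD mulrDl.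
Qed.

Lemma gauss_integralZ c k r :
  gauss_integral c (k *: r) = k * gauss_integral c r.
Proof.
rewrite /gauss_integral -RintegralZl//; last exact: integrable_gauss.
by apply: eq_Rintegral => x _; rewrite hornerZ mulrA.
Qed.

Lemma gauss_integral_sqr_ge0 c r : 0 <= gauss_integral c (r ^+ 2).
Proof.
by apply: Rintegral_ge0 => x _; rewrite mulr_ge0 ?expR_ge0// horner_exp sqr_ge0.
Qed.

(** A nonnegative integrand of integral 0 vanishes almost everywhere; the weight is positive, and a
    nonzero r has only finitely many roots, a null set. *)
Lemma gauss_integral_sqr_eq0 c r : gauss_integral c (r ^+ 2) = 0 -> r = 0.
Proof.
move=> I0; apply: contrapT => /eqP r0.
pose f x := (r ^+ 2).[x] * gauss_weight c x.
have intf : mu.-integrable setT (EFin \o f) := integrable_gauss c (r ^+ 2).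
have f0 x : 0 <= f x by rewrite mulr_ge0 ?expR_ge0// horner_exp sqr_ge0.
have : (\int[mu]_x `|(f x)%:E| = 0)%E.
  under eq_integral do rewrite gee0_abs ?lee_fin//.
  rewrite -[LHS]fineK; last exact: integrable_fin_num.
  by rewrite [fine _]I0.
move/(ae_eq_integral_abs mu measurableT (measurable_int _ intf)) => aef.
have r_ae : {ae mu, forall x, r.[x] != 0}.
  have Zc : countable [set` rootsR r].
    exact/finite_set_countable/finite_seq.
  exists [set` rootsR r]; split; [exact: countable_measurable| |].
    exact: countable_lebesgue_measure0.
  move=> x /= /negP; rewrite negbK => rx.
  by rewrite -(roots_on_rootsR r0) in_itv.
(* The two almost-everywhere properties contradict each other at each point, so the whole line would
   be null, against the measure of [0, 1]. *)
have [A [mA A0 subA]] : {ae mu, forall x : R, False}.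
  move: aef r_ae; apply: filterS2 => x fx0 /negP; apply.
  have /eqP := EFin_inj (fx0 Logic.I).
  by rewrite mulf_eq0 [expR _ == 0]gt_eqF ?expR_gt0// orbF horner_exp sqrf_eq0.
have : (mu `[0%R, 1%R]%classic <= mu A)%E.
  by apply: le_measure; rewrite ?inE// => x _; apply: subA.
by rewrite A0 lebesgue_measure_itv/= lte_fin ltr01 EFinN sube0 lee_fin ler10.
Qed.
End GaussianFunctional.

(** * Gaussian integrals of complex polynomials *)

Section ComplexGaussian.
Variable R : realType.
Notation C := R[i].
Implicit Types (c x : R) (r s : {poly R}) (p q : {poly C}).

Definition Re_poly p : {poly R} := map_poly (@complex.Re R) p.
Definition Im_poly p : {poly R} := map_poly (@complex.Im R) p.
Definition C_poly r : {poly C} := map_poly (real_complex R) r.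
Definition conj_poly p : {poly C} := map_poly (@conjc R) p.

Lemma coef_Re_poly p k : (Re_poly p)`_k = complex.Re p`_k.
Proof. by rewrite coef_map_id0. Qed.

Lemma coef_Im_poly p k : (Im_poly p)`_k = complex.Im p`_k.
Proof. by rewrite coef_map_id0. Qed.

Lemma coef_C_poly r k : (C_poly r)`_k = (r`_k)%:C.
Proof. exact: coef_map. Qed.

Lemma coef_conj_poly p k : (conj_poly p)`_k = (p`_k)^*.
Proof. exact: coef_map. Qed.

Lemma poly_ReIm p : p = C_poly (Re_poly p) + 'i *: C_poly (Im_poly p).
Proof.
apply/polyP => k; rewrite coefD coefZ !coef_C_poly coef_Re_poly coef_Im_poly.
by rewrite -complexE.
Qed.

Lemma conj_poly_ReIm p :
  conj_poly p = C_poly (Re_poly p) - 'i *: C_poly (Im_poly p).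
Proof.
apply/polyP => k; rewrite coef_conj_poly coefB coefZ !coef_C_poly coef_Re_poly coef_Im_poly.
by case: (p`_k) => u v; simpc.
Qed.

Lemma horner_C_poly r x : (C_poly r).[x%:C] = (r.[x])%:C.
Proof. exact: horner_map. Qed.

Lemma horner_conj_poly p x : (conj_poly p).[x%:C] = (p.[x%:C])^*.
Proof. by rewrite -[x%:C in LHS]conjc_real horner_map. Qed.

Lemma horner_Re_poly p x : complex.Re p.[x%:C] = (Re_poly p).[x].
Proof.
rewrite [in LHS](poly_ReIm p) hornerD hornerZ !horner_C_poly.
by simpc.
Qed.

Lemma horner_Im_poly p x : complex.Im p.[x%:C] = (Im_poly p).[x].
Proof.
rewrite [in LHS](poly_ReIm p) hornerD hornerZ !horner_C_poly.
by simpc.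
Qed.

Definition cgauss c p : C :=
  gauss_integral c (Re_poly p) +i* gauss_integral c (Im_poly p).

Lemma cgaussD c p q : cgauss c (p + q) = cgauss c p + cgauss c q.
Proof.
rewrite /cgauss.
have -> : Re_poly (p + q) = Re_poly p + Re_poly q.
  by apply/polyP => k; rewrite coefD !coef_Re_poly coefD; case: (p`_k); case: (q`_k).
have -> : Im_poly (p + q) = Im_poly p + Im_poly q.
  by apply/polyP => k; rewrite coefD !coef_Im_poly coefD; case: (p`_k); case: (q`_k).
by rewrite !gauss_integralD.
Qed.

Lemma gauss_integralB c r s :
  gauss_integral c (r - s) = gauss_integral c r - gauss_integral c s.
Proof. by rewrite -scaleN1r gauss_integralD gauss_integralZ mulN1r. Qed.

Lemma cgaussZ c k p : cgauss c (k *: p) = k * cgauss c p.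
Proof.
case: k => u v; rewrite /cgauss.
have -> : Re_poly ((u +i* v) *: p) = u *: Re_poly p - v *: Im_poly p.
  apply/polyP => k; rewrite coefB !coefZ !coef_Re_poly coef_Im_poly coefZ.
  by case: (p`_k).
have -> : Im_poly ((u +i* v) *: p) = u *: Im_poly p + v *: Re_poly p.
  apply/polyP => k; rewrite coefD !coefZ !coef_Im_poly coef_Re_poly coefZ.
  by case: (p`_k).
by rewrite gauss_integralB gauss_integralD !gauss_integralZ.
Qed.

Lemma cgauss_C_poly c r : cgauss c (C_poly r) = (gauss_integral c r)%:C.
Proof.
rewrite /cgauss (_ : Re_poly _ = r); last first.
  by apply/polyP => k; rewrite coef_Re_poly coef_C_poly.
rewrite (_ : Im_poly _ = 0 *: r) ?gauss_integralZ ?mul0r//.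
by apply/polyP => k; rewrite coef_Im_poly coef_C_poly scale0r coef0.
Qed.

Lemma cgauss_deriv c p : cgauss c (p^`() + ((2 * c)%:C%:P - 2 *: 'X) * p) = 0.
Proof.
have realcase r : cgauss c ((C_poly r)^`() + ((2 * c)%:C%:P - 2 *: 'X) * C_poly r) = 0.
  have -> : (C_poly r)^`() + ((2 * c)%:C%:P - 2 *: 'X) * C_poly r =
      C_poly (r^`() + ((2 * c)%:P - 2 *: 'X) * r).
    rewrite /C_poly rmorphD rmorphM rmorphB /= map_polyC map_polyZ map_polyX.
    by rewrite deriv_map /= rmorph_nat.
  by rewrite cgauss_C_poly gauss_integral_deriv.
rewrite [p]poly_ReIm derivD derivZ mulrDr -scalerAr addrACA -scalerDr.
by rewrite cgaussD cgaussZ !realcase mulr0 addr0.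
Qed.

(** Reduces definiteness of the matrix form to integrals of real squares. *)
Lemma cgauss_normE c p : cgauss c (p * conj_poly p) =
  (gauss_integral c (Re_poly p ^+ 2) + gauss_integral c (Im_poly p ^+ 2))%:C.
Proof.
rewrite -gauss_integralD -cgauss_C_poly conj_poly_ReIm {1}[p]poly_ReIm.
rewrite /C_poly rmorphD !rmorphXn /=; congr (cgauss c _).
move: (map_poly _ _) (map_poly _ _) => u v.
have i2 : ('i%:P : {poly C}) ^+ 2 = -1 by rewrite -rmorphXn /= sqr_i polyCN.
rewrite -!mul_polyC.
(* [ring] treats ['i] as a variable; the relation i^2 = -1 enters through this rewriting. *)
have -> : v ^+ 2 + u ^+ 2 = v ^+ 2 - ('i%:P) ^+ 2 * u ^+ 2 by rewrite i2; ring.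
ring.
Qed.

Lemma integralC_gauss b c p q :
  integralC (fun x => p.[x%:C] * (gauss_weight b x)%:C
                    + q.[x%:C] * (gauss_weight c x)%:C)
  = cgauss b p + cgauss c q.
Proof.
rewrite /integralC /cgauss; congr (_ +i* _).
- rewrite /gauss_integral -RintegralD//; [|exact: integrable_gauss..].
  apply: eq_Rintegral => x _; rewrite -!horner_Re_poly.
  by case: p.[x%:C] => ? ?; case: q.[x%:C] => ? ?; simpc.
- rewrite /gauss_integral -RintegralD//; [|exact: integrable_gauss..].
  apply: eq_Rintegral => x _; rewrite -!horner_Im_poly.
  by case: p.[x%:C] => ? ?; case: q.[x%:C] => ? ?; simpc.
Qed.

End ComplexGaussian.

(** * Symmetry of the operator *)

Section Symmetry.
Variable R : realType.
Variables a b : R.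
Notation C := R[i].
Notation T := (triang a%:C).
Implicit Types (P Q : 'M[{poly C}]_2).

Lemma opDE : opD a b = hermite_op a%:C b%:C.
Proof.
apply/polyP => k; rewrite /opD /hermite_op coef_Poly coef_order2 !rmorphM !rmorph_nat.
by case: k => [|[|[|k]]] //=; rewrite nth_nil.
Qed.

(** The form of the diagonal weight with entries [gauss_weight b] and [gauss_weight 0]. *)
Definition gauss_form (U V : 'M[{poly C}]_2) : 'M[C]_2 := \matrix_(i, j)
  (cgauss b (U i 0 * conj_poly (V j 0)) + cgauss 0 (U i 1 * conj_poly (V j 1))).

Lemma mxip_weight P Q :
  mxip (weight a b) P Q = gauss_form (P *m T) (Q *m T).
Proof.
apply/matrixP => i j; rewrite [LHS]mxE [RHS]mxE.
rewrite -integralC_gauss; congr (integralC _); apply/funext => x.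
rewrite !hornerM !horner_conj_poly !mulmx2E !mx2E !mxE /=.
rewrite !mulr0 !mulr1 !addr0 !hornerD !hornerM !hornerZ !hornerX.
have -> : gauss_weight 0 x = expR (- x ^+ 2).
  by rewrite /gauss_weight mulr0 mul0r addr0.
have -> : gauss_weight b x = expR (- x ^+ 2) * expR (2 * b * x).
  by rewrite /gauss_weight expRD.
have conjE (u v : C) (r : R) : (u * r%:C + v)^* = u^* * r%:C + v^*.
  by case: u => ? ?; case: v => ? ?; simpc.
have -> : a%:C * x%:C = (a * x)%:C by rewrite rmorphM.
rewrite conjE !(rmorphD, rmorphM, rmorphXn) /=.
ring.
Qed.

Lemma conj_C_poly (r : {poly R}) : conj_poly (C_poly r) = C_poly r.
Proof. by apply/polyP => k; rewrite coef_conj_poly coef_C_poly conjc_real. Qed.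

Lemma conj_polyD (p q : {poly C}) :
  conj_poly (p + q) = conj_poly p + conj_poly q.
Proof. exact: rmorphD. Qed.

Lemma conj_polyM (p q : {poly C}) :
  conj_poly (p * q) = conj_poly p * conj_poly q.
Proof. exact: rmorphM. Qed.

Lemma conj_poly_deriv (p : {poly C}) : conj_poly p^`() = (conj_poly p)^`().
Proof. by rewrite /conj_poly deriv_map. Qed.

(** The diagonal entries of [hermite_diag] are the cases c = b, k = -2 and c = k = 0. *)
Definition gauss_op (c k : R) (p : {poly C}) : {poly C} :=
  p^`()^`() + p^`() * (- 2 *: 'X + (2 * c%:C)%:P) + p * (k%:C)%:P.

Lemma conj_gauss_op c k p : conj_poly (gauss_op c k p) = gauss_op c k (conj_poly p).
Proof.
rewrite /gauss_op !conj_polyD !conj_polyM !conj_poly_deriv.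
congr (_ + _ * _ + _ * _); last by rewrite -[_%:P](map_polyC (real_complex R)) conj_C_poly.
have -> : - 2 *: 'X + (2 * c%:C)%:P = C_poly (- 2 *: 'X + (2 * c)%:P) :> {poly C}.
  rewrite /C_poly rmorphD /= map_polyZ map_polyX map_polyC /=.
  by rewrite [(2 * c)%:C]rmorphM [(- 2)%:C]rmorphN /= !rmorph_nat.
exact: conj_C_poly.
Qed.

Lemma cgauss_symmetric c k p q :
  cgauss c (gauss_op c k p * conj_poly q) = cgauss c (p * conj_poly (gauss_op c k q)).
Proof.
rewrite conj_gauss_op; set q' := conj_poly q.
(* The difference of the two integrands, times the weight, is the derivative of the
   weight times the Wronskian of p and conj q. *)
rewrite (_ : _ * q' = p * gauss_op c k q'
  + ((p^`() * q' - p * q'^`())^`()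
     + ((2 * c)%:C%:P - 2 *: 'X) * (p^`() * q' - p * q'^`()))).
  by rewrite cgaussD cgauss_deriv addr0.
rewrite /gauss_op derivB !derivM -!mul_polyC rmorphM rmorph_nat polyCN; ring.
Qed.

Lemma act_hermite_diag0 P i :
  act P (hermite_diag b%:C) i 0 = gauss_op b (- 2) (P i 0).
Proof.
rewrite act_order2 /gauss_op !mxE !sum_ord2 !mx2E !mxE.
by rewrite !mulr0 !addr0 [RHS]addrAC [RHS]addrC addrA rmorphN rmorph_nat; ring.
Qed.

Lemma act_hermite_diag1 P i :
  act P (hermite_diag b%:C) i 1 = gauss_op 0 0 (P i 1).
Proof.
rewrite act_order2 /gauss_op !mxE !sum_ord2 !mx2E !mxE.
by rewrite !mulr0 !addr0 !add0r; ring.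
Qed.

(** On P T and Q T the operator becomes diagonal, and each diagonal entry is symmetric for its own
    weight. *)
Lemma mxip_hermite_symmetric P Q :
  mxip (weight a b) (act P (hermite_op a%:C b%:C)) Q =
  mxip (weight a b) P (act Q (hermite_op a%:C b%:C)).
Proof.
rewrite !mxip_weight !act_hermite_triang.
move: (P *m T) (Q *m T) => U V; apply/matrixP => i j.
rewrite [LHS]mxE [RHS]mxE.
rewrite (act_hermite_diag0 U i) (act_hermite_diag1 U i).
rewrite (act_hermite_diag0 V j) (act_hermite_diag1 V j).
by congr (_ + _); exact: cgauss_symmetric.
Qed.

Lemma mxipDl P P' Q :
  mxip (weight a b) (P + P') Q = mxip (weight a b) P Q + mxip (weight a b) P' Q.
Proof.
rewrite !mxip_weight mulmxDl; move: (P *m T) (P' *m T) (Q *m T) => U U' V.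
by apply/matrixP => i j; rewrite !mxE !mulrDl !cgaussD addrACA.
Qed.

Lemma mxipDr P Q Q' :
  mxip (weight a b) P (Q + Q') = mxip (weight a b) P Q + mxip (weight a b) P Q'.
Proof.
rewrite !mxip_weight mulmxDl; move: (P *m T) (Q *m T) (Q' *m T) => U V V'.
apply/matrixP => i j; rewrite !mxE !conj_polyD !mulrDr !cgaussD.
by rewrite addrACA.
Qed.

Lemma map_polyC_mulmx (A : 'M[C]_2) P i j :
  (map_mx polyC A *m P) i j = A i 0 *: P 0 j + A i 1 *: P 1 j.
Proof. by rewrite mulmx2E !mxE !mul_polyC. Qed.

Lemma conj_polyZ (k : C) (p : {poly C}) :
  conj_poly (k *: p) = k^* *: conj_poly p.
Proof. by apply/polyP => n; rewrite coefZ !coef_conj_poly coefZ rmorphM. Qed.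

Lemma mxipMl (A : 'M[C]_2) P Q :
  mxip (weight a b) (map_mx polyC A *m P) Q = A *m mxip (weight a b) P Q.
Proof.
rewrite !mxip_weight -mulmxA; move: (P *m T) (Q *m T) => U V.
have formE i j : gauss_form U V i j = cgauss b (U i 0 * conj_poly (V j 0)) +
    cgauss 0 (U i 1 * conj_poly (V j 1)) by rewrite mxE.
apply/matrixP => i j; rewrite [RHS]mulmx2E !formE [LHS]mxE !map_polyC_mulmx.
by rewrite !mulrDl -!scalerAl !cgaussD !cgaussZ !mulrDr addrACA.
Qed.

Lemma mxipMr (A : 'M[C]_2) P Q :
  mxip (weight a b) P (map_mx polyC A *m Q) = mxip (weight a b) P Q *m adjoint_mx A.
Proof.
rewrite !mxip_weight -mulmxA; move: (P *m T) (Q *m T) => U V.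
have adjE k l : adjoint_mx A k l = (A l k)^* by rewrite !mxE.
have formE i j : gauss_form U V i j = cgauss b (U i 0 * conj_poly (V j 0)) +
    cgauss 0 (U i 1 * conj_poly (V j 1)) by rewrite mxE.
apply/matrixP => i j; rewrite [RHS]mulmx2E !adjE !formE [LHS]mxE.
rewrite !map_polyC_mulmx !conj_polyD !conj_polyZ !mulrDr -!scalerAr.
rewrite !cgaussD !cgaussZ !mulrDl (mulrC _ (A j 0)^*) (mulrC _ (A j 1)^*).
by rewrite (mulrC _ (A j 0)^*) (mulrC _ (A j 1)^*) addrACA.
Qed.

(** A diagonal entry of the form is a sum of four integrals of squares, so each vanishes and Q T =
    0; T is invertible. *)
Lemma mxip_eq0 Q : mxip (weight a b) Q Q = 0 -> Q = 0.
Proof.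
move=> QQ0; suff QT0 : Q *m T = 0.
  by rewrite -[Q]mulmx1 -(triangK a%:C) mulmxA QT0 mul0mx.
have row0 i : (Q *m T) i 0 = 0 /\ (Q *m T) i 1 = 0.
  have := congr1 (fun M : 'M[_]_2 => M i i) QQ0.
  rewrite mxip_weight [LHS]mxE [RHS]mxE !cgauss_normE -rmorphD => /(@complexI _ _ 0) /eqP.
  rewrite paddr_eq0 ?addr_ge0 ?gauss_integral_sqr_ge0//.
  rewrite !paddr_eq0 ?gauss_integral_sqr_ge0//.
  move=> /andP[/andP[/eqP r0 /eqP i0] /andP[/eqP r1 /eqP i1]].
  rewrite [(Q *m T) i 0]poly_ReIm [(Q *m T) i 1]poly_ReIm.
  rewrite !(gauss_integral_sqr_eq0 r0, gauss_integral_sqr_eq0 i0).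
  rewrite !(gauss_integral_sqr_eq0 r1, gauss_integral_sqr_eq0 i1).
  by rewrite /C_poly !rmorph0 scaler0 addr0.
by apply: eq_mx2; rewrite [RHS]mxE; case: (row0 0); case: (row0 1).
Qed.

(** * Monic orthogonal polynomials as eigenfunctions of D *)

Variable P : nat -> 'M[{poly C}]_2.
Hypothesis orthP : monic_orthogonal (weight a b) P.

Lemma size_monic_orth n : mxsize_le n.+1 (P n).
Proof. by case: orthP => /(_ n) []. Qed.

Lemma lead_monic_orth n : mxcoef n (P n) = 1.
Proof. by case: orthP => /(_ n) []. Qed.

Lemma mxip_lower n Q : mxsize_le n Q -> mxip (weight a b) (P n) Q = 0.
Proof.
apply: (monic_seq_ind size_monic_orth lead_monic_orth
  (S := fun Q => mxip (weight a b) (P n) Q = 0)) => [|Q1 Q2 h1 h2|A m lt_m].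
- by apply: (addIr (mxip (weight a b) (P n) 0)); rewrite -mxipDr addr0 add0r.
- by rewrite mxipDr h1 h2 addr0.
- have ne_nm : n <> m by move=> eq_nm; rewrite eq_nm ltnn in lt_m.
  by rewrite mxipMr (orthP.2 _ _ ne_nm) mul0mx.
Qed.

(** Q = P_n D - Lambda_n P_n has degree below n, and so has Q D. By symmetry <Q, Q> = <P_n, Q D> -
    Lambda_n <P_n, Q>, where both terms vanish. *)
Lemma hermite_monic_orth n : act (P n) (hermite_op a%:C b%:C) =
  map_mx polyC (hermite_eigen a%:C b%:C n) *m P n.
Proof.
set D := hermite_op _ _; set A := hermite_eigen _ _ _.
pose Q := act (P n) D - map_mx polyC A *m P n.
have szQ : mxsize_le n Q.
  have szD := mxsize_hermite a%:C b%:C (size_monic_orth n).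
  apply/mxsize_leP => k; rewrite leq_eqVlt => /predU1P[<-|lt_k].
    rewrite mxcoefB mxcoef_mul mxcoef_hermite; last exact: size_monic_orth.
    by rewrite lead_monic_orth mul1mx mulmx1 subrr.
  rewrite mxcoefB mxcoef_mul ((mxsize_leP _ _).1 szD k lt_k).
  by rewrite ((mxsize_leP _ _).1 (size_monic_orth n) k lt_k) mulmx0 subrr.
suff : Q = 0 by move/eqP; rewrite subr_eq0 => /eqP.
apply: mxip_eq0; rewrite {1}/Q -mulNmx -map_mxN mxipDl mxipMl mxip_hermite_symmetric.
by rewrite !mxip_lower ?mulmx0 ?addr0//; exact: mxsize_hermite.
Qed.
End Symmetry.

Theorem theorem3p8 (R : realType) (a b : R) (ha : a <> 0) (hb : b <> 0)
    (P : nat -> 'M[{poly R[i]}]_2) (hP : monic_orthogonal (weight a b) P) :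
  in_DW P (opD a b) /\
  forall E : diffop R[i],
    in_DW P E ->
    opmul E (opD a b) = opmul (opD a b) E ->
    exists p : {poly R[i]}, E = op_horner p (opD a b).
Proof.
rewrite opDE; split=> [n|E inE comm].
  by exists (hermite_eigen a%:C b%:C n); exact: hermite_monic_orth.
have neq0 (x : R) : x <> 0 -> x%:C != 0 by move=> /eqP x0; rewrite (inj_eq (@complexI _)).
(* Gathers the matrices given separately for each n into one sequence [L]. *)
have [L actP] := choice inE.
exact: (commutant_hermite (neq0 _ ha) (neq0 _ hb) (size_monic_orth hP)
  (lead_monic_orth hP) (hermite_monic_orth hP) actP comm).
Qed.
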